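(* Let $x_1x_2x_3\cdots$ be the binary Ehrenfeucht–Mycielski sequence, and let $x\in\{0,1\}^+$ be a fixed nonempty binary string. Then, as $n\to\infty$, $$|T_n(x)| = |R_n(x)| = N_n(x) + o(n).$$
   Context: The Ehrenfeucht–Mycielski (EM) sequence $x_1x_2x_3\cdots\in\{0,1\}^{\mathbb N}$ is defined by $x_1x_2x_3=010$ and, for $n\ge 3$: let $w$ be the longest suffix of $x_1^n=x_1\cdots x_n$ that also occurs in $x_1^n$ ending at some position $j<n$; choose the largest such $j$; then $x_{n+1}=1-x_{j+1}$. For $i\le j$, $x_i^j$ denotes $x_i\cdots x_j$. $N_n(w)$ denotes the number of positions $i$ with $i+|w|-1\le n$ and $x_i^{i+|w|-1}=w$ (occurrences may overlap). $R_n$ is the set of strings in $\{0,1\}^*$ (including the empty string) that occur at least twice as substrings of $x_1^n$. $R_n(x)$ is the set of strings in $R_n$ having $x$ as a suffix. $T_n$ is the rooted tree with vertex set $R_n$, root the empty string, in which each nonempty $w=bW\in R_n$ ($b$ a bit) is a child of $W$ via an edge labelled $b$, so that the edge labels read along the path from a vertex to the root spell that vertex's string. $T_n(x)$ is the subtree of $T_n$ consisting of the vertices whose strings end with $x$, and $|T|$ denotes the number of vertices of a tree $T$. The notation $f(n)=g(n)+o(n)$ means $(f(n)-g(n))/n\to 0$. *)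

(* Defs.v *)
From mathcomp Require Import all_boot.

Set Implicit Arguments.
Unset Strict Implicit.
Unset Printing Implicit Defensive.

(* Bits are booleans (0 = false, 1 = true).  Positions in words are counted
   from 1, so [take j u] is the prefix u_1 ... u_j, a word w occurs in u ending
   at position j iff [suffix w (take j u)] (for j <= size u), and u_(j+1) is
   [nth false u j]. *)

(* Length of the longest suffix of u that also occurs in u ending at some
   position j < size u. *)
Definition em_match_len (u : seq bool) : nat :=
  \max_(k < (size u).+1 |
        [exists j : 'I_(size u), suffix (drop (size u - k) u) (take j u)]) k.

Definition em_match (u : seq bool) : seq bool :=
  drop (size u - em_match_len u) u.

Definition em_match_end (u : seq bool) : nat :=
  \max_(j < size u | suffix (em_match u) (take j u)) j.

Definition em_next (u : seq bool) : bool := ~~ nth false u (em_match_end u).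

(* The first n + 3 terms. *)
Definition em_iter (n : nat) : seq bool :=
  iter n (fun u => rcons u (em_next u)) [:: false; true; false].

(* The Ehrenfeucht-Mycielski sequence x_1 x_2 ...; the value at index 0 is
   meaningless. *)
Definition em (i : nat) : bool := nth false (em_iter i) i.-1.

(* x_i ... x_j, for 1 <= i <= j + 1 (empty when i = j + 1). *)
Definition factor (i j : nat) : seq bool := [seq em k | k <- iota i (j.+1 - i)].

Lemma size_em_iter n : size (em_iter n) = n.+3.
Proof. by elim: n => //= n IHn; rewrite size_rcons IHn. Qed.

Lemma nth_em_iter n k : k < n.+3 -> nth false (em_iter n) k = em k.+1.
Proof.
have stable m d : k < m.+3 ->
    nth false (em_iter (d + m)) k = nth false (em_iter m) k.
  move=> lt_k; elim: d => //= d IHd.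
  rewrite nth_rcons size_em_iter IHd ifT //.
  by apply: (leq_trans lt_k); rewrite !ltnS leq_addl.
move=> lt_k; rewrite /em [k.+1.-1]/=.
case: (leqP n k.+1) => [le_nk | /ltnW le_kn].
- by rewrite -(subnK le_nk) stable.
- by rewrite -(subnK le_kn) stable //; do 3!apply: leqW.
Qed.

Lemma em_iter_factor n : em_iter n = factor 1 n.+3.
Proof.
apply: (@eq_from_nth _ false) => [|k]; rewrite size_em_iter.
  by rewrite size_map size_iota subn1.
move=> lt_k; rewrite nth_em_iter // (nth_map 0) ?size_iota ?subn1 //.
by rewrite nth_iota // add1n.
Qed.

Lemma em_init : factor 1 3 = [:: false; true; false].
Proof. by rewrite -(em_iter_factor 0). Qed.

Lemma em_rec n : 3 <= n -> em n.+1 = em_next (factor 1 n).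
Proof.
case: n => [|[|[|n]]] // _.
by rewrite -em_iter_factor -(@nth_em_iter n.+1) //= nth_rcons size_em_iter
           ltnn eqxx.
Qed.

(* N_n(w). *)
Definition occurrences (n : nat) (w : seq bool) : nat :=
  count (fun i => ((i + size w).-1 <= n) && (factor i (i + size w).-1 == w))
        (iota 1 n.+1).

(* R_n.  Every substring of x_1 ... x_n has length at most n, so R_n lives in
   the finite type of words of length at most n.  The empty word belongs to it
   as soon as n >= 1. *)
Definition repeated (n : nat) : {set n.-bseq bool} :=
  [set w : n.-bseq bool | 2 <= occurrences n w].

(* R_n(x). *)
Definition repeated_ending (n : nat) (x : seq bool) : {set n.-bseq bool} :=
  [set w in repeated n | suffix x w].

(* [edge T p b c] means that c is a child of p via an edge labelled b. *)
Record labelled_tree (V : finType) := LabelledTree {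
  vertices : {set V};
  root : V;
  edge : V -> bool -> V -> bool
}.

Definition tree_card (V : finType) (T : labelled_tree V) : nat := #|vertices T|.

Definition is_rooted_tree (V : finType) (T : labelled_tree V) : Prop :=
  [/\ root T \in vertices T,
      forall p b c, edge T p b c -> (p \in vertices T) && (c \in vertices T),
      forall p b, ~~ edge T p b (root T),
      forall c, c \in vertices T -> c != root T ->
        exists! pb : V * bool, edge T pb.1 pb.2 c
    & forall c, c \in vertices T ->
        connect (fun p q => [exists b, edge T p b q]) (root T) c].

(* The tree induced on A : {set words} by the edges W -> bW. *)
Definition word_tree (n : nat) (A : {set n.-bseq bool}) (r : n.-bseq bool) :
    labelled_tree (n.-bseq bool) :=
  LabelledTree A r
    (fun W b w => [&& W \in A, w \in A & (w : seq bool) == b :: W]).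

(* T_n. *)
Definition em_tree (n : nat) : labelled_tree (n.-bseq bool) :=
  word_tree (repeated n) [bseq].

(* T_n(x).  Its root is x when x is a vertex of T_n; otherwise it has no vertex
   and the root is a dummy value. *)
Definition em_subtree (n : nat) (x : seq bool) : labelled_tree (n.-bseq bool) :=
  word_tree [set w in vertices (em_tree n) | suffix x w] (insub_bseq n x).

Lemma occurrences_cons n b w : occurrences n (b :: w) <= occurrences n w.
Proof.
pose q i := ((i + size w).-1 <= n) && (factor i (i + size w).-1 == w).
have le_q : occurrences n (b :: w) <= count q (iota (1 + 1) n.+1).
  rewrite iotaDl count_map; apply: sub_count => i /=.
  rewrite /q /factor add1n addSn addnS /= => /andP[-> /=].
  by rewrite subSn ?leq_addr //= subSS => /eqP[_ ->].
apply: leq_trans le_q _; rewrite -[n.+1]addn1 iotaD count_cat /=.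
have -> : q (2 + n) = false.
  by rewrite /q add2n !addSn leqNgt ltnS leq_addr.
by rewrite !addn0 /occurrences /= leq_addl.
Qed.

Lemma repeated_nil n : 0 < n -> [bseq] \in repeated n.
Proof. by case: n => // n _; rewrite inE. Qed.

Lemma word_tree_rooted n (A : {set n.-bseq bool}) (r : n.-bseq bool) :
    r \in A -> {in A, forall w : n.-bseq bool, suffix r w} ->
    (forall (w W : n.-bseq bool) b, w \in A -> w = b :: W :> seq bool ->
       suffix r W -> W \in A) ->
  is_rooted_tree (word_tree A r).
Proof.
move=> Ar sufA closedA.
have parent (w : n.-bseq bool) : w \in A -> w != r ->
    exists (W : n.-bseq bool) b, W \in A /\ w = b :: W :> seq bool.
  move=> Aw ne_wr; have /suffixP[s def_w] := sufA _ Aw.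
  case: s def_w => [|b s] /= def_w.
    by case/eqP: ne_wr; apply: val_inj.
  have szW : size (s ++ r) <= n.
    by rewrite -ltnS -[(size _).+1]/(size (b :: s ++ r)) -def_w ltnW // ltnS
               size_bseq.
  by exists (Bseq szW), b; split=> //; apply: (closedA w _ b) => //=;
     apply: suffix_suffix.
split=> //=.
- by move=> p b c /and3P[-> ->].
- move=> p b; apply/negP=> /and3P[Ap _ /eqP def_r].
  by have /size_suffix := sufA _ Ap; rewrite def_r /= ltnn.
- move=> w Aw ne_wr; have [W [b [AW def_w]]] := parent w Aw ne_wr.
  exists (W, b); split=> [|[W' b'] /= /and3P[_ _ /eqP]].
    by rewrite /= AW Aw def_w eqxx.
  by rewrite def_w => -[-> /val_inj->].
- move=> w; have [m] := ubnP (size w); elim: m w => // m IHm w lt_w Aw.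
  have [-> // | ne_wr] := eqVneq w r.
  have [W [b [AW def_w]]] := parent w Aw ne_wr.
  apply: connect_trans (IHm W _ AW) (connect1 _).
    by move: lt_w; rewrite def_w.
  by apply/existsP; exists b; rewrite AW Aw def_w eqxx.
Qed.

Lemma em_tree_rooted n : 0 < n -> is_rooted_tree (em_tree n).
Proof.
move=> n_gt0; apply: word_tree_rooted.
- exact: repeated_nil.
- by move=> w _; apply: suffix0s.
- move=> w W b; rewrite !inE => w2 def_w _; move: w2; rewrite def_w => w2.
  exact: leq_trans w2 (occurrences_cons _ _ _).
Qed.

Lemma em_subtree_rooted n (x : n.-bseq bool) :
  x \in repeated n -> is_rooted_tree (em_subtree n x).
Proof.
move=> Rx; have rx : insub_bseq n x = x by rewrite /insub_bseq /insubd valK.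
rewrite /em_subtree rx; apply: word_tree_rooted.
- by rewrite inE Rx suffix_refl.
- by move=> w; rewrite inE => /andP[].
- move=> w W b; rewrite !inE => /andP[w2 _] def_w -> ; rewrite andbT.
  by move: w2; rewrite def_w => /leq_trans; apply; apply: occurrences_cons.
Qed.

(* Main.v *)
(** Every repeated word is followed by both bits in x_1 ... x_(n+1), so the
    2 |R_n| one-bit extensions of repeated words number at most
    |R_n| + n + 1, whence |R_n| <= n + 1.  Dually, view the repeated words as
    a binary tree growing to the left: all but few positions of x_1 ... x_n
    ending in a prescribed set Q of words yield distinct leaves, so
    |R_n(Q)| >= N_n(Q) - o(n).  Since the two lower bounds for Q = {x} and for
    its complement add up to n - o(n), both are tight.  The o(n) term is
    the length of the longest repeated prefix x_1 ... x_k; it is sublinear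
    because for every C almost all m < k create C new factors, so that R_n
    contains at least C (k - O(C)) words. *)

Require Import Defs.
From mathcomp Require Import all_boot all_order all_algebra zify.
From mathcomp Require Import all_classical all_reals all_analysis.
Import Order.TTheory GRing.Theory Num.Theory.
Import numFieldNormedType.Exports.

Set Implicit Arguments.
Unset Strict Implicit.
Unset Printing Implicit Defensive.
Local Open Scope nat_scope.

(** * Factors of the sequence, indexed by start and length *)

(** Starts count from 0, so this is x_(i+1) ... x_(i+l); an explicit length avoids the truncated
    subtraction in [factor]. *)
Definition word (i l : nat) : seq bool := mkseq (fun t => em (i + t).+1) l.

Lemma size_word i l : size (word i l) = l.
Proof. exact: size_mkseq. Qed.

Lemma factor_word i l : Defs.factor i.+1 (i + l) = word i l.
Proof.
rewrite /Defs.factor subSS addKn /word /mkseq -[i.+1]addn0 iotaDl -map_comp.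
by apply: eq_map => t /=; rewrite addSn.
Qed.

Lemma wordP i j l :
  reflect (forall t, t < l -> em (i + t).+1 = em (j + t).+1)
          (word i l == word j l).
Proof.
apply: (iffP eqP) => [eq_ij t lt_tl | eq_ij].
  by have := congr1 (nth false ^~ t) eq_ij; rewrite !nth_mkseq.
apply: (@eq_from_nth _ false); rewrite !size_word // => t lt_tl.
by rewrite !nth_mkseq // eq_ij.
Qed.

Lemma drop_word a i l : drop a (word i l) = word (i + a) (l - a).
Proof.
apply: (@eq_from_nth _ false); rewrite size_drop !size_word // => t lt_t.
by rewrite nth_drop !nth_mkseq ?addnA //; lia.
Qed.

Lemma take_word a i l : a <= l -> take a (word i l) = word i a.
Proof.
by move=> le_al; rewrite /word /mkseq -map_take take_iota (minn_idPl le_al).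
Qed.

Lemma rcons_word i l : rcons (word i l) (em (i + l).+1) = word i l.+1.
Proof. by rewrite /word /mkseq -[l.+1]addn1 iotaD map_cat cats1. Qed.

Lemma cons_word i l : em i.+1 :: word i.+1 l = word i l.+1.
Proof.
rewrite /word /mkseq /= addn0; congr cons; rewrite -[1]addn0 iotaDl -map_comp.
by apply: eq_map => t /=; rewrite addSn addnCA.
Qed.

(** The conjunct [k <= j] matters: for [j < k] the difference [j - k] truncates to 0 and the
    equation would compare with a word running past position j. *)
Lemma suffix_wordE k j m : k <= m -> j <= m ->
  suffix (drop (m - k) (word 0 m)) (take j (word 0 m)) =
  (k <= j) && (word (m - k) k == word (j - k) k).
Proof.
move=> le_km le_jm; rewrite suffixE take_word // !drop_word !add0n !size_word.
rewrite subKn // eq_sym; case: leqP => [le_kj | lt_jk]; first by rewrite subKn.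
by apply/eqP => /(congr1 size); rewrite !size_word; lia.
Qed.

(** * The longest earlier match of a prefix *)

Definition match_len m := em_match_len (Defs.factor 1 m).
Definition match_end m := em_match_end (Defs.factor 1 m).

(** From here on the recursion defining the sequence is used only through these five facts. *)
Lemma em_matchP m : 2 < m ->
  [/\ match_len m <= match_end m, match_end m < m,
      word (m - match_len m) (match_len m) =
        word (match_end m - match_len m) (match_len m),
      em m.+1 = ~~ em (match_end m).+1
    & forall l j, j < m -> l <= j -> word (m - l) l = word (j - l) l ->
        l <= match_len m].
Proof.
move=> m3; have def_u : Defs.factor 1 m = word 0 m by rewrite -factor_word.
have m_gt0 : 0 < m by lia.
rewrite em_rec // /em_next -/(match_end m).
have maxL l j : j < m -> l <= j -> word (m - l) l = word (j - l) l ->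
    l <= match_len m.
  move=> lt_jm le_lj eq_w; rewrite /match_len def_u /em_match_len size_word.
  have lt_lm : l < m.+1 by lia.
  apply: (@leq_bigmax_cond _ _ (fun k : 'I_m.+1 => k : nat) (Ordinal lt_lm)).
  apply/existsP; exists (Ordinal lt_jm).
  by rewrite suffix_wordE /= ?eq_w ?eqxx ?andbT //; lia.
have [lenm [j0 j0P]] : match_len m <= m /\ exists j : 'I_m,
    (match_len m <= j) && (word (m - match_len m) (match_len m) ==
                           word (j - match_len m) (match_len m)).
  rewrite /match_len def_u /em_match_len size_word.
  set A := (X in \max_(k < _ | X k) _).
  (* The empty suffix ends everywhere, so the maximum is attained and is not the default value of an
     empty range. *)
  have A_gt0 : 0 < #|[pred k | A k]|.
    apply/card_gt0P; exists ord0; rewrite inE /A; apply/existsP.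
    by exists (Ordinal m_gt0); rewrite suffix_wordE //= eqxx.
  have [k] := eq_bigmax_cond (fun k : 'I_m.+1 => k : nat) A_gt0.
  rewrite inE /A => /existsP[j]; have km := ltn_ord k.
  rewrite suffix_wordE; [|lia|exact: ltnW].
  by move=> jP ->; split; [lia|exists j].
have endP : exists2 j : 'I_m, suffix (em_match (word 0 m)) (take j (word 0 m))
    & match_end m = j.
  rewrite /match_end def_u /em_match_end size_word.
  set A := (X in \max_(k < _ | X k) _).
  have A_gt0 : 0 < #|[pred k | A k]|.
    apply/card_gt0P; exists j0; rewrite inE /A /em_match size_word.
    by rewrite -def_u -/(match_len m) def_u suffix_wordE // ltnW.
  have [j] := eq_bigmax_cond (fun k : 'I_m => k : nat) A_gt0.
  by rewrite inE; exists j.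
have [j] := endP; rewrite /em_match size_word -def_u -/(match_len m) def_u.
rewrite suffix_wordE //; last exact: ltnW.
case/andP=> le_j /eqP eq_w ->; split=> //.
by rewrite nth_mkseq.
Qed.

(** * Occurrences and repeated words *)

Definition occ n (w : seq bool) i :=
  (i + size w <= n) && (word i (size w) == w).

Lemma occurrencesE n w : occurrences n w = count (occ n w) (iota 0 n.+1).
Proof.
rewrite /occurrences -[1]addn0 iotaDl count_map; apply: eq_count => i /=.
by rewrite /occ add0n add1n factor_word.
Qed.

Definition repeats n w := 1 < occurrences n w.

Lemma repeatsP n w :
  reflect (exists i j, [/\ i < j, occ n w i & occ n w j]) (repeats n w).
Proof.
rewrite /repeats occurrencesE -size_filter; set s := seq.filter _ _.
have s_uniq : uniq s by rewrite filter_uniq ?iota_uniq.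
have memsE i : i \in s = occ n w i.
  rewrite mem_filter mem_iota /=; case occ_i: (occ n w i) => //=.
  by move: occ_i => /andP[]; lia.
apply: (iffP idP) => [|[i [j [lt_ij occ_i occ_j]]]].
  have : sorted ltn s.
    by apply: sorted_filter; [exact: ltn_trans | exact: iota_ltn_sorted].
  case: s memsE {s_uniq} => [|i [|j s]] //= memsE /andP[lt_ij _] _.
  by exists i, j; rewrite -!memsE !inE !eqxx orbT.
rewrite -[2]/(size [:: i; j]); apply: uniq_leq_size.
  by rewrite /= inE andbT; lia.
by move=> k; rewrite !inE memsE => /orP[]/eqP->.
Qed.

Lemma occ_word n i l : occ n (word i l) i = (i + l <= n).
Proof. by rewrite /occ size_word eqxx andbT. Qed.

Lemma occ_sub n i j a b l : a + b <= l ->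
  occ n (word i l) j -> occ n (word (i + a) b) (j + a).
Proof.
move=> le_abl /andP[]; rewrite !size_word => le_jn /wordP eq_w.
rewrite /occ size_word; apply/andP; split; first by lia.
by apply/wordP => t lt_tb; rewrite -!addnA eq_w //; lia.
Qed.

Lemma repeats_word n w :
  repeats n w -> exists2 i, w = word i (size w) & i + size w <= n.
Proof.
by case/repeatsP=> i [_ [_ /andP[? /eqP ?] _]]; exists i.
Qed.

Lemma repeats_sub n i a b l : a + b <= l ->
  repeats n (word i l) -> repeats n (word (i + a) b).
Proof.
move=> le_abl /repeatsP[j [k [lt_jk occ_j occ_k]]]; apply/repeatsP.
by exists (j + a), (k + a); rewrite ltn_add2r lt_jk !(occ_sub le_abl).
Qed.

(** Plain words instead of bounded ones: extensions to either side can then be compared by inclusion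
    of duplicate-free lists, without length bounds. *)
Definition repeated_words n := [seq val w | w <- enum (repeated n)].

Lemma repeated_words_uniq n : uniq (repeated_words n).
Proof. by rewrite map_inj_uniq ?enum_uniq //; apply: val_inj. Qed.

Lemma mem_repeated_words n w : (w \in repeated_words n) = repeats n w.
Proof.
apply/mapP/idP => [[v] | rw]; first by rewrite mem_enum inE => ? ->.
have [i _ le_n] := repeats_word rw.
have wn : size w <= n := leq_trans (leq_addl _ _) le_n.
by exists (Bseq wn); rewrite ?mem_enum ?inE.
Qed.

Lemma card_repeated_ending n x :
  #|repeated_ending n x| = count (suffix x) (repeated_words n).
Proof.
rewrite /repeated_words count_map cardE -size_filter.
apply/perm_size/uniq_perm; [exact: enum_uniq | exact/filter_uniq/enum_uniq|].
move=> w.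
by rewrite mem_enum inE andbC mem_filter mem_enum.
Qed.

(** * Upper bound on the number of repeated words *)

(* A suffix [w] of x_1 ... x_m with an earlier occurrence is a suffix of the
   match, so it is followed by x_{m+1} here and by its negation there. *)
Lemma occ_rcons n w b : repeats n w -> exists i, occ n.+1 (rcons w b) i.
Proof.
case/repeatsP=> i [j [lt_ij /andP[le_in /eqP wi] /andP[le_jn /eqP wj]]].
set l := size w in le_in wi le_jn wj.
have next k : k + l <= n -> word k l = w -> em (k + l).+1 = b ->
    exists i, occ n.+1 (rcons w b) i.
  move=> le_kn wk eb; exists k.
  by rewrite /occ size_rcons -/l -rcons_word wk eb eqxx addnS ltnS le_kn.
(* The recursion does not reach these ends. Since x_1 x_2 = 01, only the empty word can repeat
   there, and x_1, x_2 provide both bits. *)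
have [le_j3 | lt_3j] := leqP (j + l) 2.
  have l0 : l = 0.
    have [-> | l_gt0] := posnP l; first by [].
    have [i0 j1 l1] : [/\ i = 0, j = 1 & l = 1] by split; lia.
    by move: wi; rewrite i0 l1 -[LHS]/[:: em 1] -wj j1 l1.
  have e1 : em 1 = false by [].
  have e2 : em 2 = true by [].
  case: b next => next; [apply: (next 1) | apply: (next 0)]; rewrite ?l0 //.
  - by lia.
  - by rewrite -wi l0.
  - by rewrite -wi l0.
have [leLe lt_e eqL nextm maxL] := em_matchP lt_3j.
set m := j + l in lt_3j leLe lt_e eqL nextm maxL.
set e := match_end m in leLe lt_e eqL nextm maxL.
set L := match_len m in leLe eqL maxL.
have leL : l <= L.
  by apply: (maxL l (i + l)); rewrite /m ?leq_add2r ?leq_addl ?ltn_add2r // !addnK wi wj.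
have we : word (e - l) l = w.
  rewrite -wj; apply/eqP/wordP => t lt_tl; move/eqP/wordP: eqL => eqL.
  have := eqL (L - l + t); rewrite /m.
  have -> : e - L + (L - l + t) = e - l + t by lia.
  have -> : j + l - L + (L - l + t) = j + t by rewrite /m in lt_e *; lia.
  by move=> ->; lia.
have [eb | eb] := eqVneq (em m.+1) b; first exact: (next j).
apply: (next (e - l)) => //; first by rewrite /m in lt_e *; lia.
rewrite subnK; last by lia.
by move: eb; rewrite nextm; case: (em e.+1); case: (b).
Qed.

(** A non-repeated extension is sent to the start of its first occurrence. This is injective: of two
    different ones with the same start, the shorter would be a prefix of a repeated word, hence
    repeated. *)
Lemma size_repeated_words n : size (repeated_words n) <= n.+1.
Proof.
set R := repeated_words n.
pose E := [seq rcons w b | w <- R, b <- [:: false; true]].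
have E_uniq : uniq E.
  apply: allpairs_uniq => //; first exact: repeated_words_uniq.
  by move=> [w b] [w' b'] _ _ /= /rcons_inj[-> ->].
pose L := [seq v <- E | v \notin R].
pose first v := find (occ n.+1 v) (iota 0 n.+2).
have firstP v : v \in L -> occ n.+1 v (first v) && (first v < n.+1).
  rewrite mem_filter => /andP[_ /allpairsP[[w b] /= [Rw _ ->]]].
  have [i occ_i] : exists i, occ n.+1 (rcons w b) i.
    by apply: occ_rcons; rewrite -mem_repeated_words.
  have has_v : has (occ n.+1 (rcons w b)) (iota 0 n.+2).
    apply/hasP; exists i => //; rewrite mem_iota.
    by move: occ_i => /andP[]; lia.
  have := nth_find 0 has_v; rewrite nth_iota ?add0n; last first.
    by have := has_v; rewrite has_find size_iota.
  rewrite -/(first _) => occ_f; rewrite occ_f /=.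
  case/andP: occ_f; rewrite size_rcons addnS => le_f _.
  exact: leq_ltn_trans (leq_addr _ _) le_f.
have sizeL : size L <= n.+1.
  rewrite -(size_map first) -[n.+1](size_iota 0); apply: uniq_leq_size.
    rewrite map_inj_in_uniq ?filter_uniq // => v v' Lv Lv' eq_f.
    have /andP[/andP[_ /eqP vE] _] := firstP _ Lv.
    have /andP[/andP[_ /eqP vE'] _] := firstP _ Lv'.
    rewrite -eq_f in vE'.
    wlog le_v : v v' Lv Lv' eq_f vE vE' / size v <= size v'.
      have [le|/ltnW le] := leqP (size v) (size v') => H; first exact: H.
      by apply/esym/H => //; rewrite -eq_f.
    have [eq_s | ne_s] := eqVneq (size v) (size v').
      by rewrite -vE -vE' eq_s.
    move: Lv Lv'; rewrite !mem_filter => /andP[/negP Rv _].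
    case/andP=> _ /allpairsP[[w b] /= [Rw _ def_v']].
    case: Rv; move: Rw; rewrite !mem_repeated_words.
    have lt_vw : size v <= size w by move: ne_s le_v; rewrite def_v' size_rcons; lia.
    have -> : w = word (first v) (size w).
      by move: vE'; rewrite def_v' size_rcons -rcons_word => /rcons_inj[].
    by rewrite -{2}vE -[first v in X in _ -> X]addn0; apply: repeats_sub.
  move=> _ /mapP[v Lv ->]; rewrite mem_iota /=.
  by have /andP[] := firstP _ Lv.
have sizeE : size E = size R * 2 by rewrite size_allpairs.
have : size E <= size (R ++ L).
  apply: uniq_leq_size => // v Ev; rewrite mem_cat mem_filter Ev andbT.
  by case: (v \in R).
rewrite size_cat sizeE muln2 -addnn leq_add2l => /leq_trans; exact.
Qed.

(** * Sublinear length of repeated prefixes *)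

(* If m < m' had the same shift m - match_end m = d < C, then position m + 1
   would lie inside the match of x_1 ... x_m', which is d-periodic there,
   contradicting x_{m+1} <> x_{m+1-d}. *)
Lemma count_long_match C k :
  count (fun m => m < match_len m + C) (iota (C + 3) k) <= C.
Proof.
rewrite -size_filter; set B := seq.filter _ _.
have memB m : m \in B -> (m < match_len m + C) && (C + 3 <= m).
  by rewrite mem_filter mem_iota => /andP[-> /andP[-> _]].
rewrite -(size_map (fun m => m - match_end m)) -[leqRHS](size_iota 0).
apply: uniq_leq_size => [|_ /mapP[m /memB/andP[bad_m le_m] ->]].
  rewrite map_inj_in_uniq ?filter_uniq ?iota_uniq // => m m' Bm Bm' eq_d.
  wlog lt_m : m m' Bm Bm' eq_d / m < m'.
    have [lt|lt|//] := ltngtP m m' => H; first exact: H.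
    exact/esym/H.
  have /andP[bad_m le_m] := memB m Bm; have /andP[bad_m' le_m'] := memB m' Bm'.
  have [|leL lt_e _ next _] := @em_matchP m; first by lia.
  have [|leL' lt_e' /eqP/wordP eqL' _ _] := @em_matchP m'; first by lia.
  (* Since [m' - match_len m' < C < m < m'], position m + 1 lies in the match of x_1 ... x_m'; hence
     the range starting at [C + 3]. *)
  have := eqL' (m - (m' - match_len m')).
  have -> : m' - match_len m' + (m - (m' - match_len m')) = m by lia.
  have -> : match_end m' - match_len m' + (m - (m' - match_len m')) = match_end m.
    by lia.
  rewrite next => H; suff: ~~ em (match_end m).+1 = em (match_end m).+1.
    by case: (em _).
  by apply: H; lia.
rewrite mem_iota /=; have [|leL lt_e _ _ _] := @em_matchP m; lia.
Qed.

(* Almost every m < k has its match shorter than m - C, and then the C longest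
   suffixes of x_1 ... x_m are factors of x_1 ... x_k that did not occur before. *)
Lemma repeated_prefix_bound C n k :
  repeats n (word 0 k) -> (k - (C + C + 3)) * C <= n.+1.
Proof.
move=> rep_k; apply: leq_trans (size_repeated_words n).
pose G := [seq m <- iota (C + 3) (k - (C + 3)) | match_len m + C <= m].
(* The range omits the first [C + 3] values of m, and at most C others have a long match. *)
have sizeG : k - (C + C + 3) <= size G.
  have := count_predC (fun m => m < match_len m + C) (iota (C + 3) (k - (C + 3))).
  have := count_long_match C (k - (C + 3)).
  rewrite size_iota size_filter (@eq_count _ (predC _) (fun m => match_len m + C <= m)).
    by lia.
  by move=> m /=; rewrite -leqNgt.
have GP m : m \in G -> [/\ match_len m + C <= m, C + 3 <= m & m < k].
  by rewrite mem_filter mem_iota; case/and3P; split=> //; lia.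
apply: (@leq_trans (size [seq word d (m - d) | m <- G, d <- iota 0 C])).
  by rewrite size_allpairs size_iota leq_mul2r sizeG orbT.
apply: uniq_leq_size => [|_ /allpairsP[[m d] /= [Gm + ->]]].
  apply: allpairs_uniq; rewrite ?filter_uniq ?iota_uniq //.
  move=> _ _ /allpairsP[[m d] /= [Gm + ->]] /allpairsP[[m' d'] /= [Gm' + ->]].
  rewrite !mem_iota /= !add0n => lt_d lt_d' eq_w.
  wlog le_m : m m' d d' Gm Gm' lt_d lt_d' eq_w / m <= m'.
    have [le|/ltnW le] := leqP m m' => H; first exact: H.
    exact/esym/H.
  have [good_m le3 _] := GP m Gm; have [good_m' le3' _] := GP m' Gm'.
  have eq_l := congr1 size eq_w; rewrite !size_word in eq_l.
  have [eq_m|ne_m] := eqVneq m m'; first by congr (_, _); lia.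
  (* For m < m' the common word would be a suffix of x_1 ... x_m' longer than [match_len m'] that
     already ends at m. *)
  have [|_ _ _ _ maxL] := @em_matchP m'; first by lia.
  have := maxL (m' - d') m; rewrite subKn; last by lia.
  by rewrite -eq_w -eq_l subKn; [move=> H; have := H _ _ erefl; lia | lia].
rewrite mem_iota mem_repeated_words => lt_d; have [_ le3 lt_k] := GP m Gm.
by rewrite -[d in word d _]add0n; apply: repeats_sub rep_k; lia.
Qed.

(** * Lower bound by counting leaves *)

(** [Q] is a set of words of length [l], so that one count serves both for {x} and for its
    complement. *)
Definition ends_in (l : nat) (Q : pred (seq bool)) (w : seq bool) :=
  (l <= size w) && Q (drop (size w - l) w).

Lemma ends_in_word l Q i s : s <= i ->
  ends_in l Q (word (i - s) (l + s)) = Q (word i l).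
Proof.
move=> le_si; rewrite /ends_in size_word leq_addr addKn drop_word subnK //.
by rewrite addnK.
Qed.

Lemma ends_in_cons l Q b w :
  l <= size w -> ends_in l Q (b :: w) = ends_in l Q w.
Proof. by move=> le_l; rewrite /ends_in /= leqW // le_l subSn. Qed.

(* Each i whose prefix x_1 ... x_(i+l) is not repeated yields a leaf, the
   shortest non-repeated suffix; words of length > l among repeated words and
   leaves have a repeated parent, and each word has at most two children. *)
Lemma count_word_le n l Q K :
    (forall k, repeats n (word 0 k) -> k < K) ->
  count (fun i => Q (word i l)) (iota 0 (n.+1 - l)) <=
    count (ends_in l Q) (repeated_words n) + 2 ^ l + K.
Proof.
move=> ltK; rewrite -!size_filter; set P := seq.filter _ _.
set RQ := [seq w <- repeated_words n | ends_in l Q w].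
have RQE w : (w \in RQ) = ends_in l Q w && repeats n w.
  by rewrite mem_filter mem_repeated_words.
pose P' := [seq i <- P | K <= i].
pose uniq_at i s := ~~ repeats n (word (i - s) (l + s)).
pose d i := find (uniq_at i) (iota 0 i.+1).
pose leaf i := word (i - d i) (l + d i).
have P'P i : i \in P' -> [/\ K <= i, Q (word i l) & i + l <= n].
  rewrite !mem_filter mem_iota; case/and4P=> -> -> _ lt_i; split=> //; lia.
(* The witness [s = i] gives the prefix of length [l + i], which is not repeated because
   [K <= i]. *)
have has_leaf i : i \in P' -> has (uniq_at i) (iota 0 i.+1).
  case/P'P=> le_K _ _; apply/hasP; exists i; first by rewrite mem_iota /=.
  by rewrite /uniq_at subnn; apply/negP => /ltK; lia.
have le_d i : i \in P' -> d i <= i.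
  by move=> /has_leaf; rewrite has_find size_iota.
have leafN i : i \in P' -> ~~ repeats n (leaf i).
  move=> P'i; have := nth_find 0 (has_leaf i P'i).
  by rewrite nth_iota ?add0n //; apply: le_d.
have parent i s : i \in P' -> s < d i -> repeats n (word (i - s) (l + s)).
  move=> P'i lt_s; have le_di := le_d i P'i; have := before_find 0 lt_s.
  by rewrite nth_iota ?add0n => [/negbFE //|]; lia.
have leaf_inj : {in P' &, injective leaf}.
  move=> i i'; wlog lt_i : i i' / i < i'.
    have [lt|lt|//] := ltngtP i i' => H P'i P'i' eq_w; first exact: H.
    exact/esym/H.
  move=> P'i P'i' eq_w; case/negP: (leafN i P'i).
  have eq_d : d i = d i'.
    by have := congr1 size eq_w; rewrite !size_word; lia.
  have [[_ _ le_in] [_ _ le_in']] := (P'P i P'i, P'P i' P'i').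
  have [le_di le_di'] := (le_d i P'i, le_d i' P'i').
  apply/repeatsP; exists (i - d i), (i' - d i'); split; first by lia.
    by rewrite occ_word; lia.
  by rewrite eq_w occ_word; lia.
have sizeP : size P <= size P' + K.
  rewrite -[X in _ + X](size_iota 0) -size_cat; apply: uniq_leq_size.
    by rewrite filter_uniq ?iota_uniq.
  move=> i Pi; rewrite mem_cat mem_filter Pi mem_iota /= andbT add0n.
  by case: leqP.
pose roots := [seq tval t | t <- enum {: l.-tuple bool}].
have rootsP w : size w = l -> w \in roots.
  move=> sz; have szw : size w == l by rewrite sz.
  by apply/mapP; exists (Tuple szw); rewrite ?mem_enum.
have size_roots : size roots = 2 ^ l.
  by rewrite size_map -cardE card_tuple card_bool.
pose children := [seq b :: w | b <- [:: false; true], w <- RQ].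
have childP b w : ends_in l Q w -> repeats n w -> b :: w \in children.
  move=> Qw rw; apply/allpairsP; exists (b, w); split=> //=.
    by case: b.
  by rewrite RQE Qw.
(* In numbers, |RQ| + |P'| <= 2^l + 2 |RQ|; cancelling |RQ| bounds |P'|, and P has at most K further
   positions. *)
have : size (RQ ++ map leaf P') <= size (roots ++ children).
  apply: uniq_leq_size.
    rewrite cat_uniq filter_uniq ?repeated_words_uniq //=.
    rewrite map_inj_in_uniq // !filter_uniq ?iota_uniq // andbT.
    apply/hasPn => _ /mapP[i P'i ->].
    by rewrite RQE (negPf (leafN i P'i)) andbF.
  move=> w; rewrite mem_cat (mem_cat _ roots) => /orP[|/mapP[i P'i ->]].
    rewrite RQE => /andP[Qw rw].
    have [/rootsP-> // | ne_l] := eqVneq (size w) l.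
    case: w ne_l Qw rw => [|b w] /= ne_l Qw rw.
      by move: Qw ne_l; rewrite /ends_in /= leqn0 => /andP[/eqP->].
    have le_l : l <= size w by move: Qw ne_l => /andP[/= le _] ne; lia.
    apply/orP; right; apply: childP; first by rewrite -(ends_in_cons Q b).
    exact: leq_trans rw (occurrences_cons _ _ _).
  rewrite /leaf; case def_d: (d i) => [|s].
    by rewrite rootsP ?size_word ?addn0.
  have := le_d i P'i; rewrite def_d => lt_si.
  rewrite addnS -cons_word subnSK //; apply/orP; right; apply: childP.
    by rewrite ends_in_word ?(ltnW lt_si) //; have [] := P'P i P'i.
  by apply: parent; rewrite ?def_d.
rewrite size_cat (size_cat roots) size_allpairs size_roots size_map.
rewrite mul2n -addnn addnCA leq_add2l [2 ^ l + _]addnC => le_P'.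
by apply: leq_trans sizeP _; rewrite leq_add2r.
Qed.

(** * Tightness of the bounds and the limit *)

Lemma occurrences_count n x :
  size x <= n ->
  occurrences n x =
    count (fun i => word i (size x) == x) (iota 0 (n.+1 - size x)).
Proof.
move=> le_x; rewrite occurrencesE -{1}(@subnK (size x) n.+1) ?leqW //.
rewrite iotaD count_cat.
rewrite [X in _ + X](@eq_in_count _ _ pred0) ?count_pred0 => [|i]; last first.
  by rewrite mem_iota /occ => /andP[le_i _]; apply/andP=> -[]; lia.
rewrite addn0; apply: eq_in_count => i; rewrite mem_iota /occ => /andP[_ lt_i].
by rewrite (_ : i + _ <= n); last lia.
Qed.

(** The second bound comes from the complement: r <= n + 1 - r' <= n + 1 - a' + 2^l + K = a + l +
    2^l + K. *)
Lemma repeated_ending_bound x n K :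
    size x <= n -> (forall k, repeats n (word 0 k) -> k < K) ->
  occurrences n x <= #|repeated_ending n x| + (size x + 2 ^ size x + K) /\
  #|repeated_ending n x| <= occurrences n x + (size x + 2 ^ size x + K).
Proof.
move=> le_x ltK; set l := size x.
have endsE w : suffix x w = ends_in l (pred1 x) w.
  rewrite suffixE /ends_in /=; case: leqP => //= lt_w.
  apply/eqP => /(congr1 size); rewrite size_drop => sz.
  by move: lt_w; rewrite ltnNge /l -sz leq_subr.
pose I := iota 0 (n.+1 - l); pose R := repeated_words n.
pose a := count (fun i => word i l == x) I.
pose a' := count (fun i => word i l != x) I.
pose r := count (ends_in l (pred1 x)) R.
pose r' := count (ends_in l (predC1 x)) R.
have sum_a : a + a' = n.+1 - l by rewrite -(size_iota 0 (_ - l)); apply: count_predC.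
have le_a : a <= r + 2 ^ l + K := count_word_le l (pred1 x) ltK.
have le_a' : a' <= r' + 2 ^ l + K := count_word_le l (predC1 x) ltK.
have le_r : r + r' <= n.+1.
  apply: leq_trans (size_repeated_words n).
  rewrite -(count_predC (ends_in l (pred1 x))) leq_add2l.
  by apply: sub_count => w; rewrite /ends_in /= => /andP[-> ->].
rewrite card_repeated_ending (eq_count endsE) occurrences_count //.
rewrite -/l -/I -/a -/R -/r.
by split; lia.
Qed.

(** With truncated subtraction, the two inequalities together bound the absolute difference by 2n /
    C. *)
Lemma repeated_ending_asymp x C : 0 < C -> exists N, forall n, N <= n ->
  C * (#|repeated_ending n x| - occurrences n x) <= n + n /\
  C * (occurrences n x - #|repeated_ending n x|) <= n + n.
Proof.
(* [D] collects the error terms independent of n; once [C * D <= n], C times the full error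
   [D + n %/ C] is at most 2n. *)
move=> C_gt0; set D := size x + 2 ^ size x + (C + C + 5).
exists (size x + C * D) => n le_Dn.
have ltK k : repeats n (word 0 k) -> k < C + C + 5 + n %/ C.
  move=> /(@repeated_prefix_bound C); rewrite -leq_divRL // => le_k.
  have : n.+1 %/ C <= n %/ C + 1.
    have -> : n %/ C + 1 = (n + C) %/ C by rewrite divnDr ?divnn ?C_gt0.
    by apply: leq_div2r; lia.
  by lia.
have [|le1 le2] := repeated_ending_bound _ ltK (x := x); first by lia.
have le_div := leq_trunc_div n C.
have le3 : C * D + n %/ C * C <= n + n by lia.
split; apply: leq_trans le3; rewrite [n %/ C * C]mulnC -mulnDr leq_mul2l;
  apply/orP; right; rewrite /D; lia.
Qed.

Local Open Scope classical_set_scope.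
Local Open Scope ring_scope.

Theorem theorem1 (R : realType) (x : seq bool) (hx : x != [::]) :
  (forall n : nat, tree_card (em_subtree n x) = #|repeated_ending n x|) /\
  (((#|repeated_ending n x|%:R - (occurrences n x)%:R) / n%:R : R)
     @[n --> \oo] --> (0 : R)).
Proof.
(* The vertex set of [em_subtree n x] is [repeated_ending n x] by conversion. *)
split=> //; apply/cvgrPdist_le => e e_gt0.
(* Chosen with 2 / e < C, so that 2n / C <= e n. *)
pose C := (Num.truncn (2 / e)).+1.
have le_C : 2 <= e * C%:R.
  by rewrite mulrC -ler_pdivrMr //; apply/ltW/truncnS_gt.
have [N leN] := @repeated_ending_asymp x C isT.
near=> n.
have [le1 le2] : (C * (#|repeated_ending n x| - occurrences n x) <= n + n /\
    C * (occurrences n x - #|repeated_ending n x|) <= n + n)%N.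
  by apply: leN; near: n; exists N.
have n_gt0 : 0 < n%:R :> R by rewrite ltr0n; near: n; exists 1%N.
rewrite sub0r normrN normrM normfV [`|n%:R|]ger0_norm ?ler0n // ler_pdivrMr //.
(* When a < b the truncated difference carries no information, but the real one is negative. *)
have dist a b : (C * (a - b) <= n + n)%N -> (a%:R - b%:R : R) <= e * n%:R.
  move=> le_ab; have [le_ba | lt_ab] := leqP b a; last first.
    apply: (@le_trans _ _ 0); first by rewrite subr_le0 ler_nat ltnW.
    by rewrite mulr_ge0 ?ler0n // ltW.
  rewrite -natrB // -(ler_pM2l (_ : 0 < C%:R :> R)) ?ltr0n // -natrM.
  apply: (@le_trans _ _ (2 * n%:R)).
    by rewrite -natrM ler_nat mul2n -addnn.
  by rewrite mulrA [C%:R * e]mulrC ler_wpM2r ?ler0n.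
by rewrite ler_norml dist // lerNl opprB dist.
Unshelve. all: by end_near.
Qed.
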